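(* Let $C$ be a category acting on a groupoid $G$, in the sense that axioms (A1)–(A6) of the context hold, and suppose in addition that $G$ is principal (A7) and that for all $a,b\in C$, $x\in G$ with $a\cdot x$ and $b\cdot x$ defined, $\mathbf{d}(a\cdot x)=\mathbf{d}(b\cdot x)$ if and only if $\mathbf{r}(a\cdot x)=\mathbf{r}(b\cdot x)$ (A8). Then: (1) $J(C,G)$ is an ordered groupoid. (2) $J(C,G)$ is $\ast$-inductive if and only if for all identities $e,f\in G$, whenever $C\cdot e\cap C\cdot f$ is non-empty there exists an identity $i\in G$ such that $C\cdot e\cap C\cdot f=C\cdot i$.
   Context: A category is regarded as a (small) set of arrows with a partial product; $C_o$ is its set of identities, $\mathbf{d}(x)$ and $\mathbf{r}(x)$ are the domain and range identities of $x$, and $xy$ is defined (written $\exists xy$) iff $\mathbf{d}(x)=\mathbf{r}(y)$. A groupoid is principal if there is at most one arrow between any two identities. An ordered groupoid is a groupoid $G$ with a partial order $\leq$ on the set $G$ such that: (i) $x\leq y$ implies $x^{-1}\leq y^{-1}$; (ii) if $x\leq y$, $u\leq v$, $\exists xu$ and $\exists yv$ then $xu\leq yv$; (iii) if $e$ is an identity with $e\leq\mathbf{d}(x)$ then there is a unique element $(x\,|\,e)\leq x$ with $\mathbf{d}(x\,|\,e)=e$; (iv) if $e$ is an identity with $e\leq\mathbf{r}(x)$ then there is a unique element $(e\,|\,x)\leq x$ with $\mathbf{r}(e\,|\,x)=e$. It is $\ast$-inductive if any two identities which have a lower bound have a greatest lower bound. Action of a category $C$ on a groupoid $G$: given $\pi:G\to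 C_o$, put $C\ast G=\{(a,x)\in C\times G:\mathbf{d}(a)=\pi(x)\}$; an action is a function $C\ast G\to G$, $(a,x)\mapsto a\cdot x$ (write $\exists a\cdot x$ for $(a,x)\in C\ast G$), such that: (A1) $\exists\pi(x)\cdot x$ and $\pi(x)\cdot x=x$. (A2) $\exists a\cdot x$ implies $\pi(a\cdot x)=\mathbf{r}(a)$. (A3) $\exists a\cdot(b\cdot x)$ iff $\exists(ab)\cdot x$, and if they exist they are equal. (A4) $\exists a\cdot x$ iff $\exists a\cdot\mathbf{d}(x)$, and then $\mathbf{d}(a\cdot x)=a\cdot\mathbf{d}(x)$; $\exists a\cdot x$ iff $\exists a\cdot\mathbf{r}(x)$, and then $\mathbf{r}(a\cdot x)=a\cdot\mathbf{r}(x)$. (A5) If $\pi(x)=\pi(y)$ and $\exists xy$ then $\pi(xy)=\pi(x)$. (A6) If $\exists a\cdot(xy)$ then $\exists(a\cdot x)(a\cdot y)$ and $a\cdot(xy)=(a\cdot x)(a\cdot y)$. Put $C\cdot x=\{a\cdot x:\exists a\cdot x\}$. Define $x\preceq y$ in $G$ iff $x=a\cdot y$ for some $a\in C$ (a preorder), and $x\equiv y$ iff $x\preceq y$ and $y\preceq x$. $J(C,G)$ is the set of $\equiv$-classes $[x]$, ordered by $[x]\leq[y]$ iff $x\preceq y$, with $\mathbf{d}[x]=[\mathbf{d}(x)]$, $\mathbf{r}[x]=[\mathbf{r}(x)]$, and partial product defined exactly when $\mathbf{d}[x]=\mathbf{r}[y]$ by $[x][y]=[x'y']$ where $x'\in[x]$,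 $y'\in[y]$ and $\exists x'y'$. *)

(* Defs.v *)
From Stdlib Require Relation_Definitions.
From mathcomp Require Import all_boot.
From mathcomp Require Import boolp classical_sets.

Set Implicit Arguments.
Unset Strict Implicit.
Unset Printing Implicit Defensive.

Local Open Scope classical_set_scope.
Local Open Scope quotient_scope.

(* A set of arrows with a partial product.  The product is given by its graph:
   [pmul x y z] means that xy is defined and equal to z. *)
Record pcat := Pcat {
  arrow :> Type;
  pdom : arrow -> arrow;
  prng : arrow -> arrow;
  pmul : arrow -> arrow -> arrow -> Prop
}.

Section Categories.
Variable C : pcat.
Implicit Types x y z e f : C.

Definition identity e :=
  (forall x z, pmul e x z -> z = x) /\ (forall x z, pmul x e z -> z = x).

Record category : Prop := Category {
  pmul_unique : forall x y z z', pmul x y z -> pmul x y z' -> z = z';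
  pmul_defined : forall x y, (exists z, pmul x y z) <-> pdom x = prng y;
  pdom_identity : forall x, identity (pdom x);
  prng_identity : forall x, identity (prng x);
  pmul_pdom : forall x, pmul x (pdom x) x;
  pmul_prng : forall x, pmul (prng x) x x;
  pdom_pmul : forall x y z, pmul x y z -> pdom z = pdom y;
  prng_pmul : forall x y z, pmul x y z -> prng z = prng x;
  pmul_assoc : forall x y z w,
    (exists2 u, pmul x y u & pmul u z w) <-> (exists2 v, pmul y z v & pmul x v w)
}.

Definition inverse x y := pmul x y (prng x) /\ pmul y x (pdom x).

Record groupoid : Prop := Groupoid {
  groupoid_category : category;
  groupoid_inverse : forall x, exists y, inverse x y
}.

Definition principal :=
  forall x y, pdom x = pdom y -> prng x = prng y -> x = y.

Section Order.
Variable le : C -> C -> Prop.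

Record ordered_groupoid : Prop := OrderedGroupoid {
  ordered_groupoid_groupoid : groupoid;
  ordered_groupoid_order : Relation_Definitions.order C le;
  le_inverse : forall x y x' y',
    le x y -> inverse x x' -> inverse y y' -> le x' y';
  le_pmul : forall x y u v xu yv,
    le x y -> le u v -> pmul x u xu -> pmul y v yv -> le xu yv;
  restriction : forall x e, identity e -> le e (pdom x) ->
    exists! z, le z x /\ pdom z = e;
  corestriction : forall x e, identity e -> le e (prng x) ->
    exists! z, le z x /\ prng z = e
}.

Definition star_inductive := forall e f, identity e -> identity f ->
  (exists z, le z e /\ le z f) ->
  exists m, [/\ le m e, le m f & forall z, le z e -> le z f -> le z m].

End Order.
End Categories.

(* [act a x y] means that a.x is defined and equal to y. *)
Record action (C G : pcat) := Action {
  base : G -> C;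
  act : C -> G -> G -> Prop;
  base_identity : forall x, identity (base x);
  act_unique : forall a x y y', act a x y -> act a x y' -> y = y';
  act_defined : forall a x, (exists y, act a x y) <-> pdom a = base x;
  act_base : forall x, act (base x) x x;
  base_act : forall a x y, act a x y -> base y = prng a;
  act_pmul : forall a b x y,
    (exists2 z, act b x z & act a z y) <-> (exists2 c, pmul a b c & act c x y);
  act_pdom_defined : forall a x,
    (exists y, act a x y) <-> (exists y, act a (pdom x) y);
  act_pdom : forall a x y, act a x y -> act a (pdom x) (pdom y);
  act_prng_defined : forall a x,
    (exists y, act a x y) <-> (exists y, act a (prng x) y);
  act_prng : forall a x y, act a x y -> act a (prng x) (prng y);
  base_pmul : forall x y z, base x = base y -> pmul x y z -> base z = base x;
  act_morph : forall a x y xy z, pmul x y xy -> act a xy z ->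
    exists x' y', [/\ act a x x', act a y y' & pmul x' y' z]
}.

Section ClassGroupoid.
Variables (C G : pcat) (A : action C G).
Implicit Types x y z : G.

Definition act_orbit x : set G := [set y | exists a, act A a x y].

Definition prec x y := exists a, act A a y x.

Lemma prec_preorder : Relation_Definitions.preorder G prec.
Proof.
split; first by move=> x; exists (base A x); exact: act_base.
move=> x y z [a ax] [b bx].
have [|c _ cz] := (act_pmul A a b z x).1; first by exists y.
by exists c.
Qed.

Definition equivb (x y : {classic G}) : bool := `[< prec x y /\ prec y x >].

Lemma equivb_refl : reflexive equivb.
Proof. by move=> x; apply/asboolP; split; exact: Relation_Definitions.preord_refl prec_preorder x. Qed.

Lemma equivb_sym : symmetric equivb.
Proof.
by move=> x y; apply: asbool_equiv_eq; split=> -[].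
Qed.

Lemma equivb_trans : transitive equivb.
Proof.
move=> y x z /asboolP[xy yx] /asboolP[yz zy]; apply/asboolP; split.
  exact: Relation_Definitions.preord_trans prec_preorder _ _ _ xy yz.
exact: Relation_Definitions.preord_trans prec_preorder _ _ _ zy yx.
Qed.

Canonical equivb_equiv := EquivRel equivb equivb_refl equivb_sym equivb_trans.

Definition classes := {eq_quot equivb}.

Definition class (x : G) : classes := \pi_classes (x : {classic G}).

Lemma class_eq x y : class x = class y <-> prec x y /\ prec y x.
Proof. by split=> [/eqquotP/asboolP|h] //; apply/eqquotP/asboolP. Qed.

Lemma class_repr (X : classes) : class (repr X) = X.
Proof. exact: reprK. Qed.

Definition class_dom (X : classes) : classes := class (pdom (repr X : G)).
Definition class_rng (X : classes) : classes := class (prng (repr X : G)).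

(* Uniqueness of the product is not built in here; it is part of [category]. *)
Definition class_mul (X Y Z : classes) : Prop :=
  class_dom X = class_rng Y /\
  exists x y z, [/\ class x = X, class y = Y, pmul x y z & class z = Z].

Definition J : pcat := Pcat class_dom class_rng class_mul.

Definition J_le (X Y : J) : Prop := prec (repr (X : classes)) (repr (Y : classes)).

Lemma class_domE x : class_dom (class x) = class (pdom x).
Proof.
have /class_eq[[a ax] [b bx]] := class_repr (class x).
by apply/class_eq; split; [exists a | exists b]; exact: act_pdom.
Qed.

Lemma class_rngE x : class_rng (class x) = class (prng x).
Proof.
have /class_eq[[a ax] [b bx]] := class_repr (class x).
by apply/class_eq; split; [exists a | exists b]; exact: act_prng.
Qed.

Lemma J_leE x y : J_le (class x) (class y) <-> prec x y.
Proof.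
have /class_eq[x1 x2] := class_repr (class x).
have /class_eq[y1 y2] := class_repr (class y).
have tr := Relation_Definitions.preord_trans _ _ prec_preorder.
by split=> xy; [apply: tr x2 (tr _ _ _ xy y1) | apply: tr x1 (tr _ _ _ xy y2)].
Qed.

End ClassGroupoid.

(* Main.v *)
Require Import Defs.
From mathcomp Require Import all_boot.
From mathcomp Require Import boolp classical_sets.
Set Implicit Arguments.
Unset Strict Implicit.
Unset Printing Implicit Defensive.

Local Open Scope classical_set_scope.

(* Under (A7) and (A8) an element [a.x] is determined by [x] and its domain
   (or its range).  Hence two lower bounds of [x] compare in the preorder as
   soon as their domains (or ranges) do; this gives uniqueness of restrictions
   and corestrictions in J(C,G).  It also lets a single element of C move both
   factors of a product, so that (A6) makes the product of classes well defined
   and monotone.  Part (2) is a translation, since [C.x] represents the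
   principal order ideal below [[x]]. *)

(** * Identities and inverses in a category *)

Section CategoryLemmas.
Context (C : pcat) (hC : category C).

Lemma pdom_of_identity (e : C) : identity e -> pdom e = e.
Proof. by case=> /(_ _ _ (pmul_pdom hC e)). Qed.

Lemma prng_of_identity (e : C) : identity e -> prng e = e.
Proof. by case=> _ /(_ _ _ (pmul_prng hC e)). Qed.

Lemma identityP (e : C) : pdom e = e -> identity e.
Proof. by move=> <-; exact: pdom_identity. Qed.

Lemma pdomK (x : C) : pdom (pdom x) = pdom x.
Proof. exact/pdom_of_identity/pdom_identity. Qed.

Lemma prng_pdom (x : C) : prng (pdom x) = pdom x.
Proof. exact/prng_of_identity/pdom_identity. Qed.

Lemma pdom_prng (x : C) : pdom (prng x) = prng x.
Proof. exact/pdom_of_identity/prng_identity. Qed.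

Lemma pdom_prng_pmul (x y z : C) : pmul x y z -> pdom x = prng y.
Proof. by move=> xy; apply/(pmul_defined hC); exists z. Qed.

Lemma pdom_inverse (x y : C) : inverse x y -> pdom y = prng x.
Proof. by case=> /(pdom_pmul hC) + _; rewrite pdom_prng. Qed.

Lemma prng_inverse (x y : C) : inverse x y -> prng y = pdom x.
Proof. by case=> _ /(prng_pmul hC); rewrite prng_pdom. Qed.

Lemma inverse_unique (x y y' : C) : inverse x y -> inverse x y' -> y = y'.
Proof.
move=> ixy [xy' y'x].
(* Associativity turns [y = (y'x)y] into [y = y'(xy)], where [xy] is an identity. *)
have [v xyv y'vy'] : exists2 v, pmul x y v & pmul y' v y.
  apply/(pmul_assoc hC); exists (pdom x) => //.
  by rewrite -(prng_inverse ixy); exact: pmul_prng.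
move: y'vy'; rewrite -(pmul_unique hC ixy.1 xyv).
by have [_ /[apply]] := prng_identity hC x.
Qed.

End CategoryLemmas.

(** * The action preorder and its interplay with domains, ranges and products *)

Section ActionLemmas.
Context (C G : pcat) (hG : groupoid G) (A : action C G).
Let hcG := groupoid_category hG.

Lemma prec_refl x : prec A x x.
Proof. exact: Relation_Definitions.preord_refl (prec_preorder A) x. Qed.

Lemma prec_trans y x z : prec A x y -> prec A y z -> prec A x z.
Proof. exact: Relation_Definitions.preord_trans (prec_preorder A) x y z. Qed.

Lemma prec_pdom x y : prec A x y -> prec A (pdom x) (pdom y).
Proof. by case=> a /act_pdom; exists a. Qed.

Lemma prec_prng x y : prec A x y -> prec A (prng x) (prng y).
Proof. by case=> a /act_prng; exists a. Qed.

Lemma prec_identity x e : identity e -> prec A x e -> identity x.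
Proof.
move=> ie [a ae]; apply: (identityP hcG); have := act_pdom ae.
by rewrite (pdom_of_identity hcG ie) => /act_unique; exact.
Qed.

(** By (A4), whatever acts on the domain of an arrow acts on the whole arrow; this is the source of
    restrictions. *)
Lemma act_lift_pdom a x e : act A a (pdom x) e -> exists2 y, act A a x y & pdom y = e.
Proof.
move=> ae; have [y ay] := (act_pdom_defined A a x).2 (ex_intro _ e ae).
by exists y => //; exact: act_unique (act_pdom ay) ae.
Qed.

Lemma act_lift_prng a x e : act A a (prng x) e -> exists2 y, act A a x y & prng y = e.
Proof.
move=> ae; have [y ay] := (act_prng_defined A a x).2 (ex_intro _ e ae).
by exists y => //; exact: act_unique (act_prng ay) ae.
Qed.

(** The identity [base A x] fixes [x], hence also its domain by (A4), and (A2) then determines both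
    bases. *)
Lemma base_pdom x : base A (pdom x) = base A x.
Proof.
have ax := act_base A x.
by rewrite [RHS](base_act ax); exact: base_act (act_pdom ax).
Qed.

Lemma base_prng x : base A (prng x) = base A x.
Proof.
have ax := act_base A x.
by rewrite [RHS](base_act ax); exact: base_act (act_prng ax).
Qed.

(** A converse to (A6): the factors share a base, so (A5) gives the product that base as well and
    [a] acts on it; then (A6) identifies the result. *)
Lemma act_pmul_lift a x y z x' y' z' : pmul x y z -> pmul x' y' z' ->
  act A a x x' -> act A a y y' -> act A a z z'.
Proof.
move=> xy x'y' ax ay.
have bxy : base A x = base A y.
  by rewrite -base_pdom (pdom_prng_pmul hcG xy) base_prng.
have [w aw] : exists w, act A a z w.
  apply/act_defined; rewrite (base_pmul bxy xy).
  by apply/act_defined; exists x'.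
have [u [v [au av uv]]] := act_morph xy aw.
rewrite -(act_unique ax au) -(act_unique ay av) in uv.
by rewrite (pmul_unique hcG x'y' uv).
Qed.

(** * Consequences of (A7) and (A8) *)

Context (hA7 : principal G)
  (hA8 : forall (a b : C) (x y z : G), act A a x y -> act A b x z ->
     (pdom y = pdom z <-> prng y = prng z)).

Lemma prec_inj_pdom x y z :
  prec A y x -> prec A z x -> pdom y = pdom z -> y = z.
Proof. by move=> [a ax] [b bx] yz; apply: hA7 => //; apply/(hA8 ax bx). Qed.

Lemma prec_inj_prng x y z :
  prec A y x -> prec A z x -> prng y = prng z -> y = z.
Proof. by move=> [a ax] [b bx] yz; apply: hA7 => //; apply/(hA8 ax bx). Qed.

(** The element carrying [pdom z] to [pdom y] carries [z] to some [w] below [x] with the domain of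
    [y], which forces [w = y]. *)
Lemma prec_reflect_pdom x y z :
  prec A y x -> prec A z x -> prec A (pdom y) (pdom z) -> prec A y z.
Proof.
move=> yx zx [c /act_lift_pdom[w cw wy]].
have wz : prec A w z by exists c.
by rewrite (prec_inj_pdom yx (prec_trans wz zx) (esym wy)).
Qed.

Lemma prec_reflect_prng x y z :
  prec A y x -> prec A z x -> prec A (prng y) (prng z) -> prec A y z.
Proof.
move=> yx zx [c /act_lift_prng[w cw wy]].
have wz : prec A w z by exists c.
by rewrite (prec_inj_prng yx (prec_trans wz zx) (esym wy)).
Qed.

Lemma prec_pmul x y z x' y' z' : pmul x y z -> pmul x' y' z' ->
  prec A x' x -> prec A y' y -> prec A z' z.
Proof.
move=> xy x'y' x'x [b by']; exists b; apply: (act_pmul_lift xy x'y') => //.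
(* Since [prng y = pdom x] and [prng y' = pdom x'], the same [b] moves [pdom x] to [pdom x'], and so
   moves [x] to [x']. *)
have := act_prng by'.
rewrite -(pdom_prng_pmul hcG xy) -(pdom_prng_pmul hcG x'y').
move=> /act_lift_pdom[w bw wx'].
have wx : prec A w x by exists b.
by rewrite (prec_inj_pdom x'x wx (esym wx')).
Qed.

Lemma prec_inverse x y x' y' :
  prec A x y -> inverse x x' -> inverse y y' -> prec A x' y'.
Proof.
move=> [a ax] /[dup] /(pdom_inverse hcG) dx /(prng_inverse hcG) rx.
move=> /[dup] /(pdom_inverse hcG) dy /(prng_inverse hcG) ry.
have := act_prng ax; rewrite -dy => /act_lift_pdom[w aw dw].
(* Principality suffices here: [w] and [x'] have the same domain and the same range. *)
exists a; rewrite (_ : x' = w) //; apply: hA7; first by rewrite dw.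
rewrite rx; apply: act_unique (act_prng aw).
by rewrite ry; exact: act_pdom.
Qed.

(** (A6) splits [b.u] into [b.x] and [b.y]. The reverse comparisons hold because [x] shares its
    range, and [y] its domain, with [u]. Associativity in [J A] uses this to change the
    representative of an inner product. *)
Lemma factor_class x y u u' : pmul x y u -> class A u' = class A u ->
  exists x' y', [/\ class A x' = class A x, class A y' = class A y & pmul x' y' u'].
Proof.
move=> xy /class_eq[[b bu] uu'].
have [x' [y' [bx by' x'y']]] := act_morph xy bu.
exists x', y'; split=> //; apply/class_eq; split; first by exists b.
- apply: (prec_reflect_prng (x := x)); [exact: prec_refl | by exists b |].
  by rewrite -(prng_pmul hcG xy) -(prng_pmul hcG x'y'); exact: prec_prng.
- by exists b.
- apply: (prec_reflect_pdom (x := y)); [exact: prec_refl | by exists b |].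
  by rewrite -(pdom_pmul hcG xy) -(pdom_pmul hcG x'y'); exact: prec_pdom.
Qed.

(** * The groupoid of classes *)

Lemma class_ind (P : J A -> Prop) : (forall x, P (class A x)) -> forall X, P X.
Proof. by move=> h X; rewrite -(class_repr X). Qed.

Lemma class_mulE x y z : pmul x y z -> class_mul (class A x) (class A y) (class A z).
Proof.
move=> xy; split; last by exists x, y, z.
by rewrite class_domE class_rngE (pdom_prng_pmul hcG xy).
Qed.

Lemma class_identity e : identity e -> @identity (J A) (class A e).
Proof.
move=> ie; have idE e' : class A e' = class A e -> identity e'.
  (* Every representative of the class of an identity is an identity, so products with it collapse
     already in [G]. *)
  by move=> /class_eq[+ _]; exact: prec_identity.
split=> X Z [_ [x [y [z [hx hy xy hz]]]]]; subst Z X.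
  by have [/(_ _ _ xy)-> _] := idE _ hx.
by have [_ /(_ _ _ xy)->] := idE _ hy.
Qed.

Lemma J_category : category (J A).
Proof.
split=> /=.
- move=> X Y Z Z' [_ [x [y [z [<- <- xy <-]]]]].
  move=> [_ [x' [y' [z' [/class_eq[x1 x2] /class_eq[y1 y2] xy' <-]]]]].
  by apply/class_eq; split; apply: prec_pmul; eassumption.
- elim/class_ind=> x; elim/class_ind=> y; split; first by case=> Z [].
  (* Moving [y] by [a] gives [y'] in the same class whose range is exactly [pdom x], so that [x] and
     [y'] compose. *)
  rewrite class_domE class_rngE => /class_eq[[a /act_lift_prng[y' ay' y'x]] xy].
  have [z x'y'] := (pmul_defined hcG x y').2 (esym y'x).
  exists (class A z); rewrite (_ : class A y = class A y'); first exact: class_mulE.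
  apply/class_eq; split; last by exists a.
  apply: (prec_reflect_prng (x := y)); [exact: prec_refl | by exists a |].
  by rewrite y'x.
- elim/class_ind=> x; rewrite class_domE.
  exact/class_identity/pdom_identity.
- elim/class_ind=> x; rewrite class_rngE.
  exact/class_identity/prng_identity.
- elim/class_ind=> x; rewrite class_domE.
  exact/class_mulE/pmul_pdom.
- elim/class_ind=> x; rewrite class_rngE.
  exact/class_mulE/pmul_prng.
- move=> X Y Z [_ [x [y [z [_ <- xy <-]]]]].
  by rewrite !class_domE (pdom_pmul hcG xy).
- move=> X Y Z [_ [x [y [z [<- _ xy <-]]]]].
  by rewrite !class_rngE (prng_pmul hcG xy).
- move=> X Y Z W; split.
    move=> [U [_ [x [y [u [<- <- xy <-]]]]] [_ [u' [z [w [uu' <- uz <-]]]]]].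
    have [x' [y' [<- <- xy']]] := factor_class xy uu'.
    have [v yz xv] := (pmul_assoc hcG _ _ _ _).1 (ex_intro2 _ _ _ xy' uz).
    by exists (class A v); exact: class_mulE.
  move=> [V [_ [y [z [v [<- <- yz <-]]]]] [_ [x [v' [w [<- vv' xv <-]]]]]].
  have [y' [z' [<- <- yz']]] := factor_class yz vv'.
  have [u xy uz] := (pmul_assoc hcG _ _ _ _).2 (ex_intro2 _ _ _ yz' xv).
  by exists (class A u); exact: class_mulE.
Qed.

Lemma class_inverse x y : inverse x y -> @inverse (J A) (class A x) (class A y).
Proof.
by case=> xy yx; split; rewrite /= ?class_domE ?class_rngE; exact: class_mulE.
Qed.

Lemma J_groupoid : groupoid (J A).
Proof.
split; first exact: J_category.
elim/class_ind=> x; have [y xy] := groupoid_inverse hG x.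
by exists (class A y); exact: class_inverse.
Qed.

(** * The order on classes *)

Lemma J_ordered_groupoid : ordered_groupoid (@J_le C G A).
Proof.
split.
- exact: J_groupoid.
- split.
  + by elim/class_ind=> x; apply/J_leE/prec_refl.
  + elim/class_ind=> x; elim/class_ind=> y; elim/class_ind=> z.
    by move=> /J_leE xy /J_leE yz; apply/J_leE; exact: prec_trans xy yz.
  + elim/class_ind=> x; elim/class_ind=> y.
    by move=> /J_leE xy /J_leE yx; exact/class_eq.
- elim/class_ind=> x; elim/class_ind=> y X' Y' /J_leE xy iX iY.
  have [x' ix] := groupoid_inverse hG x; have [y' iy] := groupoid_inverse hG y.
  (* An arbitrary inverse of a class is the class of an inverse in [G]. *)
  rewrite (inverse_unique J_category iX (class_inverse ix)).
  rewrite (inverse_unique J_category iY (class_inverse iy)).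
  by apply/J_leE; exact: prec_inverse ix iy.
- move=> X Y U V XU YV + + [_ [x [u [xu [hx hu xxu hxu]]]]].
  move=> + + [_ [y [v [yv [hy hv yyv hyv]]]]]; subst.
  by move=> /J_leE xy /J_leE uv; apply/J_leE; apply: prec_pmul; eassumption.
- elim/class_ind=> x; elim/class_ind=> e _ /=.
  (* The restriction is the class of [a.x], where [a] carries [pdom x] to [e]. *)
  rewrite class_domE => /J_leE[a /act_lift_pdom[z az ze]].
  exists (class A z); split=> [|Z].
    by split; [apply/J_leE; exists a | rewrite class_domE ze].
  elim/class_ind: Z => w [/J_leE wx]; rewrite class_domE -ze => /class_eq[we ew].
  by apply/class_eq; split; apply: (prec_reflect_pdom (x := x)) => //; exists a.
- elim/class_ind=> x; elim/class_ind=> e _ /=.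
  rewrite class_rngE => /J_leE[a /act_lift_prng[z az ze]].
  exists (class A z); split=> [|Z].
    by split; [apply/J_leE; exists a | rewrite class_rngE ze].
  elim/class_ind: Z => w [/J_leE wx]; rewrite class_rngE -ze => /class_eq[we ew].
  by apply/class_eq; split; apply: (prec_reflect_prng (x := x)) => //; exists a.
Qed.

(** * Meets of identities and intersections of orbits *)

Lemma J_identity_class E : @identity (J A) E -> exists2 e, identity e & class A e = E.
Proof.
elim/class_ind: E => x /(pdom_of_identity J_category) /=.
rewrite class_domE => <-; exists (pdom x) => //; exact: pdom_identity.
Qed.

Lemma J_star_inductiveP : star_inductive (@J_le C G A) <->
  forall e f : G, identity e -> identity f ->
    act_orbit A e `&` act_orbit A f !=set0 ->
    exists i : G, identity i /\ act_orbit A e `&` act_orbit A f = act_orbit A i.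
Proof.
split=> [si e f ie jf [g [ge gf]]|h E F].
  have [|M []] := si (class A e) (class A f) (class_identity ie) (class_identity jf).
    by exists (class A g); split; apply/J_leE.
  elim/class_ind: M => i /J_leE ei /J_leE fi glb.
  exists i; split; first exact: prec_identity ie ei.
  apply/seteqP; split=> [x [xe xf]|x xi]; first by apply/J_leE/glb; apply/J_leE.
  by split; exact: prec_trans xi _.
move=> /J_identity_class[e ie <-] /J_identity_class[f jf <-] [Z].
elim/class_ind: Z => z [/J_leE ze /J_leE zf].
have [//|//||i [_ efi]] := h e f; first by exists z.
(* As [i] lies in its own orbit, the orbit equation makes it a lower bound of [e] and [f]. *)
have : act_orbit A i i by exact: prec_refl.
rewrite -efi => -[ei fi]; exists (class A i); split; [exact/J_leE | exact/J_leE |].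
elim/class_ind=> w /J_leE we /J_leE wf; apply/J_leE.
by have : act_orbit A i w by rewrite -efi.
Qed.

End ActionLemmas.

Theorem theorem4p2 (C G : pcat) (hC : category C) (hG : groupoid G)
  (A : action C G) (hA7 : principal G)
  (hA8 : forall (a b : C) (x y z : G), act A a x y -> act A b x z ->
     (pdom y = pdom z <-> prng y = prng z)) :
  ordered_groupoid (@J_le C G A) /\
  (star_inductive (@J_le C G A) <->
   forall e f : G, identity e -> identity f ->
     act_orbit A e `&` act_orbit A f !=set0 ->
     exists i : G, identity i /\ act_orbit A e `&` act_orbit A f = act_orbit A i).
Proof.
by split; [exact: J_ordered_groupoid | exact: J_star_inductiveP].
Qed.
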